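(* Let $M$ be a left $R$-module which is a self-progenerator in $\sigma[M]$. Assume $M$ is strongly harmonic and $\Lambda^{fi}(M)$ is compact. Then the frame $\Psi(M)$ is regular.
   Context: $R$ is an associative ring with identity; modules are unital left $R$-modules. A submodule $N\leq M$ is fully invariant if $f(N)\subseteq N$ for all $f\in\mathrm{End}_R(M)$; $\Lambda^{fi}(M)$ is the complete lattice of fully invariant submodules of $M$ ordered by inclusion, and $Max^{fi}(M)$ is the set of its coatoms (maximal proper elements). $\sigma[M]$ is the full subcategory of $R$-Mod of all modules that embed in a quotient of some direct sum $M^{(X)}$. $M$ is $N$-projective if for every epimorphism $\rho\colon N\to X$ and every homomorphism $\alpha\colon M\to X$ there is $\beta\colon M\to N$ with $\rho\beta=\alpha$; $M$ is projective in $\sigma[M]$ if it is $N$-projective for every $N\in\sigma[M]$. $M$ is a self-progenerator in $\sigma[M]$ if it is projective in $\sigma[M]$ and every submodule of $M$ is $M$-generated (a quotient of some $M^{(X)}$). For $N,L\leq M$ put $N_ML=\sum\{f(N)\mid f\in\mathrm{Hom}_R(M,L)\}$. For $K\leq M$ put $\mathrm{Ann}_M(K)=\bigcap\{\ker f\mid f\in\mathrm{Hom}_R(M,K)\}$. $M$ is strongly harmonic if for every two distinct $N,L\in Max^{fi}(M)$ there exist $N',L'\in\Lambda^{fi}(M)$ with $L'\nleq L$, $N'\nleq N$ and $L'_MN'=0$. $\Lambda^{fi}(M)$ is compact if whenever $M=\sum_{i\in I}N_i$ with all $N_i\in\Lambda^{fi}(M)$, there is a finite $F\subseteq I$ with $M=\sum_{i\in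 F}N_i$. $\Psi(M)=\{N\in\Lambda^{fi}(M)\mid N+\mathrm{Ann}_M(Rn)=M\text{ for all }n\in N\}$, ordered by inclusion; it is a frame with joins given by sums and finite meets by intersections. Regularity of $\Psi(M)$ means that for every $N\in\Psi(M)$, $N=\sum\{K\in\Psi(M)\mid K\leq N,\ N+K^r=M\}$, where $K^r=\sum\{L\in\Psi(M)\mid L_MK=0\}$ (here $L_MK=L\cap K$ for $L,K\in\Psi(M)$, so this is the usual regularity of a frame; the condition $N+K^r=M$ already forces $K\leq N$). *)

(* Defs.v *)
From HB Require Import structures.
From mathcomp Require Import all_boot all_algebra.
From mathcomp Require Import all_classical.

Set Implicit Arguments.
Unset Strict Implicit.
Unset Printing Implicit Defensive.

Import GRing.Theory.
Local Open Scope classical_set_scope.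
Local Open Scope ring_scope.

(* The direct sum M^(X), as the functions X -> M with finite support. *)
Section DirectSum.
Variables (R : pzRingType) (M : lmodType R) (X : Type).

Definition finite_support : {pred X -> M} :=
  fun f => `[< finite_set [set x | f x != 0] >].

Lemma finite_support_submod_closed : submod_closed finite_support.
Proof.
split=> [|a f g /asboolP ffin /asboolP gfin]; apply/asboolP.
  apply: (sub_finite_set (B := set0)) => // x /=.
  by rewrite (_ : (0 : X -> M) x = 0) ?eqxx.
apply: (sub_finite_set (B := [set x | f x != 0] `|` [set x | g x != 0])).
  move=> x /=; rewrite (_ : (a *: f + g) x = a *: f x + g x) // => fgx.
  apply/orP; rewrite -negb_and; apply: contra fgx => /andP[/eqP-> /eqP->].
  by rewrite scaler0 addr0.
by rewrite finite_setU.
Qed.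

HB.instance Definition _ :=
  GRing.isSubmodClosed.Build R (X -> M) finite_support
    finite_support_submod_closed.

Record direct_sum := DirectSum {
  direct_sum_val :> X -> M;
  _ : direct_sum_val \in finite_support
}.

HB.instance Definition _ := [isSub for direct_sum_val].
HB.instance Definition _ := [Choice of direct_sum by <:].
HB.instance Definition _ := [SubChoice_isSubLmodule of direct_sum by <:].

End DirectSum.

Arguments direct_sum {R} M X.

Section Modules.
Variables (R : pzRingType) (M : lmodType R).

(* N belongs to sigma[M]: it embeds in a quotient Q of some M^(X). *)
Definition in_sigma (N : lmodType R) : Prop :=
  exists (X : Type) (Q : lmodType R)
    (p : {linear direct_sum M X -> Q}) (i : {linear N -> Q}),
    set_surj setT setT p /\ injective i.

(* Epimorphisms of modules are the surjective homomorphisms. *)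
Definition is_projective_wrt (N : lmodType R) : Prop :=
  forall (X : lmodType R) (rho : {linear N -> X}) (alpha : {linear M -> X}),
    set_surj setT setT rho ->
    exists beta : {linear M -> N}, rho \o beta =1 alpha.

Definition projective_in_sigma : Prop :=
  forall N : lmodType R, in_sigma N -> is_projective_wrt N.

Definition generated_by (K : set M) : Prop :=
  exists (X : Type) (f : {linear direct_sum M X -> M}), range f = K.

(* Submodules are represented by their underlying sets. *)
Definition is_submodule (N : set M) : Prop := submod_closed (mem N).

Definition self_progenerator : Prop :=
  projective_in_sigma /\ (forall K, is_submodule K -> generated_by K).

Definition fully_invariant (N : set M) : Prop :=
  is_submodule N /\ (forall f : {linear M -> M}, f @` N `<=` N).

Definition max_fully_invariant (N : set M) : Prop :=
  [/\ fully_invariant N, N <> setT &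
      forall K, fully_invariant K -> N `<=` K -> K <> setT -> K = N].

(* The sum of the submodules N i, i \in P: the finite sums of elements of
   their union. *)
Definition submodule_sum (I : Type) (P : set I) (N : I -> set M) : set M :=
  [set m | exists2 s : seq M,
     (forall x, x \in s -> (\bigcup_(i in P) N i) x) & m = \sum_(x <- s) x].

Definition submodule_add (N L : set M) : set M :=
  [set x + y | x in N & y in L].

(* Hom_R(M, K) for a submodule K of M, seen inside End_R(M). *)
Definition hom_into (K : set M) : set {linear M -> M} :=
  [set f | range f `<=` K].

(* submodule_prod N L is N_M L. *)
Definition submodule_prod (N L : set M) : set M :=
  submodule_sum (hom_into L) (fun f => f @` N).

Definition Ann (K : set M) : set M :=
  \bigcap_(f in hom_into K) [set m | f m = 0].

Definition strongly_harmonic : Prop :=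
  forall N L, max_fully_invariant N -> max_fully_invariant L -> N <> L ->
    exists N' L', [/\ fully_invariant N', fully_invariant L',
      ~ (L' `<=` L), ~ (N' `<=` N) & submodule_prod L' N' = [set 0]].

Definition compact_fully_invariant : Prop :=
  forall (I : Type) (N : I -> set M), (forall i, fully_invariant (N i)) ->
    submodule_sum setT N = setT ->
    exists2 F : set I, finite_set F & submodule_sum F N = setT.

Definition cyclic_submodule (n : M) : set M := range (fun r : R => r *: n).

Definition Psi : set (set M) :=
  [set N | fully_invariant N /\
     forall n, N n -> submodule_add N (Ann (cyclic_submodule n)) = setT].

(* K^r, the pseudocomplement of K in the frame Psi. *)
Definition Psi_compl (K : set M) : set M :=
  submodule_sum [set L | Psi L /\ submodule_prod L K = [set 0]] id.

(* Regularity of the frame Psi, whose joins are sums of submodules. *)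
Definition Psi_regular : Prop :=
  forall N, Psi N ->
    N = submodule_sum
          [set K | [/\ Psi K, K `<=` N &
                       submodule_add N (Psi_compl K) = setT]] id.

End Modules.

(* Main.v *)
Require Import Defs.
From HB Require Import structures.
From mathcomp Require Import all_boot all_algebra.
From mathcomp Require Import all_classical.

Set Implicit Arguments.
Unset Strict Implicit.
Unset Printing Implicit Defensive.

Import GRing.Theory.
Local Open Scope classical_set_scope.
Local Open Scope ring_scope.

(** Fully invariant submodules play the role of two-sided ideals, [D `<=` Ann E]
    that of a vanishing product of [D] and [E] (lemma [submodule_prod_eq0]), and
    the argument follows the one for rings, where the frame of pure ideals is the
    topology of a compact Hausdorff space, and such a space is regular because it
    is normal.

    The heart is the normality lemma [fi_normal]: if [A + N = M], there are fully
    invariant [D], [E] with vanishing product such that [D + A = M] and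
    [E + N = M].  A maximal fully invariant [P] above [A] and one [Q] above [N]
    are distinct, so strong harmonicity separates them; two successive
    compactness arguments, first over [Q] and then over [P], patch these local
    separations together ([comaximal_of_avoiding]).  The patching uses that
    annihilation and comaximality behave under sums and intersections as they do
    for ideals ([sub_Ann_add], [comaximalI]); this is where projectivity enters,
    as it splits a homomorphism into a sum of submodules ([hom_split]).

    For fully invariant [C], let [pure_part C] be the set of the [x] with
    [C + Ann (R x) = M].  As [M] generates its submodules, [pure_part C] lies in
    [C].  If [D + C = M] and the product of [D] and [E] vanishes, then [E] lies in
    [pure_part C] ([sub_pure_part]); with normality, this makes [pure_part C] an
    element of [Psi].

    Given [N] in [Psi] and [n] in [N], normality of the pair [N], [Ann (R n)]
    gives [D] and [E] of vanishing product with [D + N = M] and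
    [E + Ann (R n) = M].  Then [K = pure_part E] contains [n], and [pure_part D]
    lies in [Psi_compl K], while normality of the pair [D], [N] yields
    [N + pure_part D = M].  So [n] belongs to a [K] well inside [N]
    ([Psi_well_inside]), which is regularity. *)

(** * Submodules as modules *)

Section SubmoduleType.
Variables (R : pzRingType) (T : lmodType R) (S : set T).
Hypothesis subS : is_submodule S.

(** Carrying the proof in the predicate lets instance inference recover the
    closure properties of [S]. *)
Definition submodule_pred of is_submodule S : {pred T} := mem S.

HB.instance Definition _ :=
  GRing.isSubmodClosed.Build R T (submodule_pred subS)
    (subS : submod_closed (submodule_pred subS)).

Record submodule_type := SubmoduleType {
  submodule_val :> T;
  _ : submodule_val \in submodule_pred subS
}.

HB.instance Definition _ := [isSub for submodule_val].
HB.instance Definition _ := [Choice of submodule_type by <:].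
HB.instance Definition _ := [SubChoice_isSubLmodule of submodule_type by <:].

Lemma submodule_valP (x : submodule_type) : S (\val x).
Proof. by have := valP x; rewrite inE. Qed.

Variables (V : lmodType R) (f : {linear V -> T}).
Hypothesis fS : forall v, S (f v).

Definition corestrict (v : V) : submodule_type :=
  SubmoduleType (mem_set (fS v)).

Lemma corestrict_linear : linear corestrict.
Proof. by move=> a u v; apply: val_inj; rewrite /= linearP. Qed.

HB.instance Definition _ :=
  GRing.isLinear.Build R V submodule_type *:%R corestrict corestrict_linear.

End SubmoduleType.

Section Submodules.
Variables (R : pzRingType) (M : lmodType R).
Implicit Types A B C D E K L N P : set M.

Lemma is_submoduleP K : is_submodule K <->
  K 0 /\ forall a x y, K x -> K y -> K (a *: x + y).
Proof.
split=> [[K0 KD]|[K0 KD]].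
  split=> [|a x y Kx Ky]; first by rewrite inE in K0.
  by have := KD a x y (mem_set Kx) (mem_set Ky); rewrite inE.
split=> [|a x y]; first exact: mem_set.
by rewrite !inE; exact: KD.
Qed.

Lemma submodule0 K : is_submodule K -> K 0.
Proof. by case/is_submoduleP. Qed.

Lemma submoduleD K x y : is_submodule K -> K x -> K y -> K (x + y).
Proof. by case/is_submoduleP=> _ /(_ 1 x y); rewrite scale1r. Qed.

Lemma submoduleZ K a x : is_submodule K -> K x -> K (a *: x).
Proof.
by case/is_submoduleP=> K0 KD Kx; rewrite -[_ *: _]addr0; apply: KD.
Qed.

End Submodules.

Section SumsOfSubmodules.
Variables (R : pzRingType) (M : lmodType R).
Implicit Types A B C D E K L N P : set M.

Lemma submodule_big K (s : seq M) :
  is_submodule K -> (forall x, x \in s -> K x) -> K (\sum_(x <- s) x).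
Proof.
move=> subK sK; rewrite big_seq.
by apply: big_ind => //; [exact: submodule0 | move=> x y; exact: submoduleD].
Qed.

Lemma sub_submodule_sum (I : Type) (F : set I) (N : I -> set M) i :
  F i -> N i `<=` submodule_sum F N.
Proof.
move=> Fi x Nx; exists [:: x]; last by rewrite big_seq1.
by move=> y; rewrite inE => /eqP ->; exists i.
Qed.

Lemma submodule_sum_sub (I : Type) (F : set I) (N : I -> set M) K :
  is_submodule K -> (forall i, F i -> N i `<=` K) -> submodule_sum F N `<=` K.
Proof.
move=> subK NK _ [s sN ->]; apply: submodule_big => // x /sN [i Fi].
exact: NK.
Qed.

Lemma submodule_add_submodule A B :
  is_submodule A -> is_submodule B -> is_submodule (submodule_add A B).
Proof.
move=> sA sB; apply/is_submoduleP; split.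
  by exists 0; [exact: submodule0|exists 0; [exact: submodule0|rewrite addr0]].
move=> a _ _ [x Ax [y By <-]] [x' Ax' [y' By' <-]].
exists (a *: x + x'); first by apply: submoduleD => //; apply: submoduleZ.
exists (a *: y + y'); first by apply: submoduleD => //; apply: submoduleZ.
by rewrite scalerDr addrACA.
Qed.

Lemma submodule_add_subl A B : is_submodule B -> A `<=` submodule_add A B.
Proof.
by move=> sB x Ax; exists x => //; exists 0; [exact: submodule0|rewrite addr0].
Qed.

Lemma submodule_add_subr A B : is_submodule A -> B `<=` submodule_add A B.
Proof.
by move=> sA x Bx; exists 0; [exact: submodule0|exists x => //; rewrite add0r].
Qed.

Lemma submodule_add_sub A B K :
  is_submodule K -> A `<=` K -> B `<=` K -> submodule_add A B `<=` K.
Proof. by move=> sK AK BK _ [x /AK Kx [y /BK Ky <-]]; apply: submoduleD. Qed.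

Lemma submodule_addC A B : submodule_add A B = submodule_add B A.
Proof.
by apply/seteqP; split=> _ [x Ax [y By <-]]; exists y => //; exists x => //;
  rewrite addrC.
Qed.

Lemma comaximal_mono A A' B B' : A `<=` A' -> B `<=` B' ->
  submodule_add A B = setT -> submodule_add A' B' = setT.
Proof.
move=> AA' BB' AB; apply/seteqP; split=> // x _.
have [y Ay [z Bz <-]] : submodule_add A B x by rewrite AB.
by exists y; [exact: AA'|exists z => //; exact: BB'].
Qed.

Lemma image_submodule (V : lmodType R) (f : {linear V -> M}) (K : set V) :
  is_submodule K -> is_submodule (f @` K).
Proof.
move=> sK; apply/is_submoduleP; split.
  by exists 0; [exact: submodule0|exact: linear0].
move=> a _ _ [x Kx <-] [y Ky <-]; exists (a *: x + y); last exact: linearP.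
by apply: submoduleD => //; apply: submoduleZ.
Qed.

Lemma cyclic_submoduleP (x : M) : is_submodule (cyclic_submodule x).
Proof.
apply/is_submoduleP; split; first by exists 0 => //; rewrite scale0r.
move=> a _ _ [r _ <-] [s _ <-]; exists (a * r + s) => //.
by rewrite scalerDl scalerA.
Qed.

Lemma mem_cyclic (x : M) : cyclic_submodule x x.
Proof. by exists 1 => //; rewrite scale1r. Qed.

Lemma cyclic_submodule_sub K x :
  is_submodule K -> K x -> cyclic_submodule x `<=` K.
Proof. by move=> sK Kx _ [r _ <-]; apply: submoduleZ. Qed.

End SumsOfSubmodules.

(** * Fully invariant submodules and annihilators *)

Section FullyInvariant.
Variables (R : pzRingType) (M : lmodType R).
Implicit Types A B C D E K L N P : set M.

Lemma fully_invariantP N : fully_invariant N <->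
  is_submodule N /\ forall (f : {linear M -> M}) x, N x -> N (f x).
Proof.
split=> -[sN fN]; split=> // f; first by move=> x Nx; apply: (fN f); exists x.
by move=> _ [x Nx <-]; exact: fN.
Qed.

Lemma fi_submodule N : fully_invariant N -> is_submodule N.
Proof. by case. Qed.
Hint Resolve fi_submodule : core.

Lemma fi_hom N (f : {linear M -> M}) x : fully_invariant N -> N x -> N (f x).
Proof. by case/fully_invariantP=> _; apply. Qed.

Lemma fully_invariant0 : fully_invariant [set (0 : M)].
Proof.
apply/fully_invariantP; split=> [|f x /= ->]; last by rewrite linear0.
by apply/is_submoduleP; split=> //= a x y -> ->; rewrite scaler0 addr0.
Qed.

Lemma fully_invariantT : fully_invariant [set: M].
Proof. by apply/fully_invariantP; split=> //; apply/is_submoduleP. Qed.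

Lemma fully_invariant_add N L : fully_invariant N -> fully_invariant L ->
  fully_invariant (submodule_add N L).
Proof.
move=> fN fL; apply/fully_invariantP; split.
  by apply: submodule_add_submodule; apply: fi_submodule.
move=> f _ [x Nx [y Ly <-]]; exists (f x); first exact: fi_hom.
by exists (f y); [exact: fi_hom|rewrite linearD].
Qed.

Lemma fully_invariantI N L : fully_invariant N -> fully_invariant L ->
  fully_invariant (N `&` L).
Proof.
move=> /fully_invariantP[/is_submoduleP[N0 ND] fN].
move=> /fully_invariantP[/is_submoduleP[L0 LD] fL].
apply/fully_invariantP; split; last by move=> f x [/fN ? /fL].
apply/is_submoduleP; split=> // a x y [Nx Lx] [Ny Ly].
by split; [exact: ND|exact: LD].
Qed.

Lemma AnnP K x : Ann K x <->
  forall f : {linear M -> M}, (forall m, K (f m)) -> f x = 0.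
Proof.
split=> [Kx f fK|Kx f fK]; last by apply: Kx => m; apply: fK; exists m.
by apply: Kx => _ [m _ <-].
Qed.

Lemma Ann_anti K L : K `<=` L -> Ann L `<=` Ann K.
Proof.
by move=> KL x /AnnP Lx; apply/AnnP => f fK; apply: Lx => m; apply: KL.
Qed.

Lemma fully_invariant_Ann K : fully_invariant (Ann K).
Proof.
apply/fully_invariantP; split.
  apply/is_submoduleP; split; first by apply/AnnP => f _; rewrite linear0.
  move=> a x y /AnnP Kx /AnnP Ky; apply/AnnP => f fK.
  by rewrite linearP Kx // Ky // scaler0 addr0.
move=> g x /AnnP Kx; apply/AnnP => f fK.
exact: (Kx [the {linear M -> M} of f \o g] (fun m => fK (g m))).
Qed.
Hint Resolve fully_invariant_Ann : core.

Lemma submodule_prod_eq0 N L :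
  is_submodule N -> (submodule_prod N L = [set 0]) <-> (N `<=` Ann L).
Proof.
move=> sN; split=> [NL x Nx f fL|NL].
  have : submodule_prod N L (f x).
    by apply: (sub_submodule_sum fL); exists x.
  by rewrite NL.
apply/seteqP; split=> [|_ ->].
  apply: submodule_sum_sub; first by case: fully_invariant0.
  by move=> f fL _ [x /NL /AnnP Nx <-]; apply: Nx => m; apply: fL; exists m.
by exists [::]; rewrite ?big_nil.
Qed.

End FullyInvariant.

(** * Projectivity and generation *)

Section DirectSumInjection.
Variables (R : pzRingType) (M : lmodType R) (X : Type).

Definition delta_fun (x : X) (m : M) : X -> M :=
  fun y => if `[< y = x >] then m else 0.

Lemma delta_fun_finite x m : delta_fun x m \in @Defs.finite_support R M X.
Proof.
apply/asboolP; apply: (sub_finite_set (B := [set x])) => // y /=.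
by rewrite /delta_fun; case: asboolP => // _; rewrite eqxx.
Qed.

Definition direct_sum_in (x : X) (m : M) : direct_sum M X :=
  DirectSum (delta_fun_finite x m).

Lemma direct_sum_in_linear x : linear (direct_sum_in x).
Proof.
move=> a m n; apply: val_inj; apply/funext => y /=.
rewrite /delta_fun [RHS]/=.
rewrite -[RHS]/(a *: delta_fun x m y + delta_fun x n y) /delta_fun.
by case: asboolP => // _; rewrite scaler0 addr0.
Qed.

HB.instance Definition _ x :=
  GRing.isLinear.Build R M (direct_sum M X) *:%R (direct_sum_in x)
    (direct_sum_in_linear x).

Lemma direct_sum_val_sum (I : Type) (s : seq I) (F : I -> direct_sum M X) y :
  (\sum_(i <- s) F i) y = \sum_(i <- s) F i y.
Proof. by apply: (big_morph (fun g : direct_sum M X => g y)). Qed.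

Lemma direct_sumE (g : direct_sum M X) :
  exists s : seq X, g = \sum_(x <- s) direct_sum_in x (g x).
Proof.
have /asboolP : direct_sum_val g \in @Defs.finite_support R M X by case: g.
move=> /(@finite_seqP {classic X}) [s gs].
exists (undup s); apply: val_inj; apply/funext => y /=.
rewrite direct_sum_val_sum /= /delta_fun.
have [gy|gy] := eqVneq (g y) 0.
  by rewrite gy big1 // => x _; case: asboolP => // <-.
have ys : (y : {classic X}) \in undup s.
  by rewrite mem_undup; have : [set` s] y by rewrite -gs.
rewrite (bigD1_seq (y : {classic X})) ?undup_uniq //= asboolT //.
by rewrite big1 ?addr0 // => x /eqP xy; rewrite asboolF // => yx; apply: xy.
Qed.

End DirectSumInjection.

Section Lifting.
Variables (R : pzRingType) (M : lmodType R).
Implicit Types A B C D E K L N P : set M.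

(** An [M]-generated [K] is the sum of the images of the homomorphisms from [M]
    to [K], so an inclusion of [K] can be tested on those images. *)
Lemma generated_sub K L : generated_by K -> is_submodule L ->
  (forall f : {linear M -> M}, (forall m, K (f m)) -> forall m, L (f m)) ->
  K `<=` L.
Proof.
move=> [X [f fK]] sL KL y; rewrite -fK => -[g _ <-].
have [s ->] := direct_sumE g; rewrite linear_sum.
apply: (big_ind L) => [|u v|x _]; [exact: submodule0|exact: submoduleD|].
apply: (KL [the {linear M -> M} of f \o direct_sum_in x]) => m.
by rewrite -fK; exists (direct_sum_in x m).
Qed.

(** The embedding into a quotient of a direct sum is trivial here: [M * M] is
    the direct sum of two copies of [M]. *)
Lemma in_sigma_pair (S : set (M * M)%type) (sS : is_submodule S) :
  in_sigma M (submodule_type sS).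
Proof.
pose p (g : direct_sum M bool) : (M * M)%type := (g true, g false).
have pL : linear p by move=> a g h.
pose pl := GRing.isLinear.Build R (direct_sum M bool) (M * M)%type *:%R p pL.
pose q : {linear direct_sum M bool -> (M * M)%type} := HB.pack p pl.
exists bool, (M * M)%type, q, \val; split; last exact: val_inj.
move=> [m n] _.
exists (direct_sum_in true m + direct_sum_in false n) => //=.
rewrite /p /= -[(_ + _) true]/(delta_fun true m true + delta_fun false n true).
rewrite -[(_ + _) false]/(delta_fun true m false + delta_fun false n false).
by rewrite /delta_fun; do 4![case: asboolP => // _]; rewrite addr0 add0r.
Qed.

Hypothesis projM : projective_in_sigma M.

(** Projectivity with respect to the submodule [S] of [M * M], applied to the
    epimorphism from [S] onto [phi @` S]. This one form covers both the splitting
    of homomorphisms along sums and their lifting along an endomorphism. *)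
Lemma lift_pair (phi : {linear (M * M)%type -> M}) (S : set (M * M)%type)
    (h : {linear M -> M}) :
  is_submodule S -> (forall m, (phi @` S) (h m)) ->
  exists b : {linear M -> (M * M)%type},
    (forall m, S (b m)) /\ forall m, phi (b m) = h m.
Proof.
move=> sS hS; pose sI := image_submodule phi sS.
have valI (z : submodule_type sS) : (phi @` S) ((phi \o \val) z).
  by exists (\val z) => //; exact: submodule_valP.
pose rho : {linear submodule_type sS -> submodule_type sI} :=
  corestrict sI valI.
pose alpha : {linear M -> submodule_type sI} := corestrict sI hS.
have rho_surj : set_surj setT setT rho.
  move=> y _; have [z Sz zy] := submodule_valP y.
  by exists (SubmoduleType (subS := sS) (mem_set Sz)) => //; apply: val_inj.
have [b bE] := projM (in_sigma_pair sS) alpha rho_surj.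
exists [the {linear M -> (M * M)%type} of \val \o b]; split=> m /=.
  exact: submodule_valP.
exact: (congr1 \val (bE m)).
Qed.

(** Lift [h] through the addition map from [A `*` B] onto [A + B]. *)
Lemma hom_split A B (h : {linear M -> M}) :
  is_submodule A -> is_submodule B -> (forall m, submodule_add A B (h m)) ->
  exists f g : {linear M -> M},
    [/\ forall m, A (f m), forall m, B (g m) & forall m, h m = f m + g m].
Proof.
move=> sA sB hAB.
pose phi : {linear (M * M)%type -> M} := [the {linear _ -> _} of fst \+ snd].
have sS : is_submodule (A `*` B).
  apply/is_submoduleP; split; first by split; apply: submodule0.
  move=> a x y [Ax Bx] [Ay By].
  by split; apply: submoduleD => //; apply: submoduleZ.
have [|b [bS bE]] := lift_pair (phi := phi) (h := h) sS.
  by move=> m; have [x Ax [y By <-]] := hAB m; exists (x, y).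
exists [the {linear M -> M} of fst \o b], [the {linear M -> M} of snd \o b].
by split=> m; [have [] := bS m|have [] := bS m|rewrite -bE].
Qed.

Lemma hom_lift_image (f h : {linear M -> M}) K :
  is_submodule K -> (forall m, (f @` K) (h m)) ->
  exists g : {linear M -> M}, (forall m, K (g m)) /\ forall m, f (g m) = h m.
Proof.
move=> sK hK.
pose phi : {linear (M * M)%type -> M} := [the {linear _ -> _} of f \o fst].
have sS : is_submodule (K `*` [set: M]).
  apply/is_submoduleP; split; first by split=> //; apply: submodule0.
  move=> a x y [Kx _] [Ky _].
  by split=> //; apply: submoduleD => //; apply: submoduleZ.
have [|b [bS bE]] := lift_pair (phi := phi) (h := h) sS.
  by move=> m; have [x Kx <-] := hK m; exists (x, 0).
exists [the {linear M -> M} of fst \o b].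
by split=> m; [have [] := bS m|rewrite -bE].
Qed.

(** For ideals, [M = (A + C)(B + C)] lies in [A B + C]. The product is replaced
    by splitting the identity as [f + g] with [f] into [B] and [g] into [C]: then
    [f] maps [A] into [A `&` B] and [C] into [C]. *)
Lemma comaximalI A B C :
  fully_invariant A -> is_submodule B -> fully_invariant C ->
  submodule_add A C = setT -> submodule_add B C = setT ->
  submodule_add (A `&` B) C = setT.
Proof.
move=> fA sB fC AC BC; apply/seteqP; split=> // m _.
have [|f [g [fB gC fg]]] :=
  hom_split (h := [the {linear M -> M} of idfun]) sB (fi_submodule fC).
  by move=> x; rewrite BC.
have [a Aa [c Cc acm]] : submodule_add A C m by rewrite AC.
exists (f a); first by split; [exact: fi_hom|exact: fB].
exists (f c + g m).
  by apply: submoduleD => //; [exact: fi_submodule|exact: fi_hom].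
by rewrite addrA -linearD acm -fg.
Qed.

Lemma sub_Ann_add D K L : is_submodule K -> is_submodule L ->
  D `<=` Ann K -> D `<=` Ann L -> D `<=` Ann (submodule_add K L).
Proof.
move=> sK sL DK DL x Dx; apply/AnnP => h hKL.
have [f [g [fK gL ->]]] := hom_split sK sL hKL.
have /AnnP/(_ f fK) -> := DK x Dx; have /AnnP/(_ g gL) -> := DL x Dx.
exact: addr0.
Qed.

End Lifting.

(** * Maximal fully invariant submodules *)

Section Maximal.
Variables (R : pzRingType) (M : lmodType R).
Hypothesis compactM : compact_fully_invariant M.
Implicit Types A B C D E K L N P : set M.

Lemma directed_union (FF : set (set M)) :
  FF !=set0 -> (forall N, FF N -> fully_invariant N) ->
  (forall N L, FF N -> FF L -> exists2 K, FF K & N `|` L `<=` K) ->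
  fully_invariant (\bigcup_(N in FF) N).
Proof.
move=> [N0 FN0] fiF dirF; apply/fully_invariantP; split; last first.
  by move=> f x [N FN Nx]; exists N => //; apply: fi_hom => //; exact: fiF.
apply/is_submoduleP; split.
  by exists N0 => //; apply: submodule0; apply: fi_submodule; exact: fiF.
move=> a x y [N FN Nx] [L FL Ly]; have [K FK NLK] := dirF _ _ FN FL.
have sK : is_submodule K by apply: fi_submodule; exact: fiF.
exists K => //; apply: submoduleD => //; last by apply: NLK; right.
by apply: submoduleZ => //; apply: NLK; left.
Qed.

(** Only finitely many members are needed to cover [M], and directedness puts
    them inside a single one. The index type of the family is the
    subtype of members of [FF], made into an equality type classically so that
    finite sets of indices can be enumerated. *)
Lemma directed_top (FF : set (set M)) :
  FF !=set0 -> (forall N, FF N -> fully_invariant N) ->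
  (forall N L, FF N -> FF L -> exists2 K, FF K & N `|` L `<=` K) ->
  \bigcup_(N in FF) N = setT -> FF setT.
Proof.
move=> [N0 FN0] fiF dirF FT.
pose I := {classic {N : set M | FF N}}.
pose val (i : I) : set M := proj1_sig i.
have [|F finF FE] := @compactM I val (fun i => fiF _ (proj2_sig i)).
  apply/seteqP; split=> // x _.
  have [N FN Nx] : (\bigcup_(N in FF) N) x by rewrite FT.
  exact: (@sub_submodule_sum _ _ I setT val (exist _ N FN)).
have [s Fs] := (finite_seqP F).1 finF.
have [K FK sK] : exists2 K, FF K & forall i, i \in s -> val i `<=` K.
  elim: s {Fs} => [|i s [K FK sK]]; first by exists N0.
  have [L FL iL] := dirF _ _ (proj2_sig i) FK.
  exists L => // j; rewrite inE => /orP[/eqP ->|/sK jK] x xj; apply: iL.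
    by left.
  by right; apply: jK.
suff <- : K = setT by [].
apply/seteqP; split=> //; rewrite -FE.
apply: submodule_sum_sub; first by apply: fi_submodule; exact: fiF.
by move=> i Fi; apply: sK; rewrite Fs in Fi.
Qed.

(** By Zorn's lemma: by compactness the union of a nonempty chain of proper
    submodules is proper. *)
Lemma exists_max_fully_invariant A : fully_invariant A -> A <> setT ->
  exists2 P, max_fully_invariant P & A `<=` P.
Proof.
move=> fA AT.
pose good N := [/\ fully_invariant N, A `<=` N & N <> setT].
have [F FP Ftot|P [PP Pmax]] := @Zorn_bigcup M [set N | N <> set0 -> good N].
  (* Exempting the empty set from the requirements lets the empty chain, whose
     union is empty, satisfy the hypothesis of Zorn's lemma. *)
  pose FF := F `&` [set N | N <> set0].
  have FFE : \bigcup_(N in F) N = \bigcup_(N in FF) N.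
    apply/seteqP; split=> x [N FN Nx].
      by exists N => //; split=> //= N0; rewrite N0 in Nx.
    by exists N => //; case: FN.
  have goodF N : FF N -> good N by case=> /FP; apply.
  rewrite /= FFE => /eqP/set0P[x [N FN _]].
  have FF0 : FF !=set0 by exists N.
  have fiF L : FF L -> fully_invariant L by case/goodF.
  have dirF K L : FF K -> FF L -> exists2 K', FF K' & K `|` L `<=` K'.
    move=> FK FL; have [KL|LK] := Ftot _ _ FK.1 FL.1.
      by exists L => // y [/KL|].
    by exists K => // y [|/LK].
  split; first exact: directed_union.
    by move=> y Ay; exists N => //; have [_ AN _] := goodF _ FN; exact: AN.
  by move=> /(directed_top FF0 fiF dirF) /goodF[].
have A0 : A 0 by apply: submodule0; exact: fi_submodule.
have /PP [fP AP PT] : P <> set0.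
  move=> P0; apply: (Pmax A); last by move=> _; split.
  by rewrite P0; split=> // /(_ 0 A0).
exists P => //; split=> // K fK PK KT; apply/seteqP; split=> //.
apply: contrapT => KP; apply: (Pmax K); first by split.
by move=> _; split=> // x /AP/PK.
Qed.

Lemma max_comaximal P D : max_fully_invariant P -> fully_invariant D ->
  ~ (D `<=` P) -> submodule_add D P = setT.
Proof.
move=> [fP PT Pmax] fD DP; apply: contrapT => DPT; apply: DP.
rewrite -(Pmax (submodule_add D P)) //.
- by apply: submodule_add_subl; exact: fi_submodule.
- exact: fully_invariant_add.
- by apply: submodule_add_subr; exact: fi_submodule.
Qed.

(** If no maximal fully invariant submodule above [N] contains all of [EE], then
    the union of the directed family of the [E + N] is contained in no maximal
    fully invariant submodule, hence is [M]; by compactness one member is [M]. *)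
Lemma comaximal_of_avoiding (EE : set (set M)) N : fully_invariant N ->
  EE !=set0 -> (forall E, EE E -> fully_invariant E) ->
  (forall E E', EE E -> EE E' -> EE (submodule_add E E')) ->
  (forall P, max_fully_invariant P -> N `<=` P ->
     exists2 E, EE E & ~ (E `<=` P)) ->
  exists2 E, EE E & submodule_add E N = setT.
Proof.
move=> fN [E0 EE0] fiE addE avoid.
have sN : is_submodule N := fi_submodule fN.
pose FF := (fun E => submodule_add E N) @` EE.
have FF0 : FF !=set0 by exists (submodule_add E0 N); exists E0.
have fiF L : FF L -> fully_invariant L.
  by case=> E EEE <-; apply: fully_invariant_add => //; exact: fiE.
have dirF K L : FF K -> FF L -> exists2 K', FF K' & K `|` L `<=` K'.
  case=> E EEE <- [E' EEE' <-].
  have sE : is_submodule E by apply: fi_submodule; exact: fiE.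
  have sE' : is_submodule E' by apply: fi_submodule; exact: fiE.
  exists (submodule_add (submodule_add E E') N).
    by exists (submodule_add E E') => //; exact: addE.
  move=> x [] [y Ey [z Nz <-]]; exists y; do 2?[by exists z].
    exact: submodule_add_subl Ey.
  exact: submodule_add_subr Ey.
suff [E EEE ET] : FF setT by exists E.
apply: directed_top => //; apply: contrapT => FT.
have [P maxP FP] :=
  exists_max_fully_invariant (directed_union FF0 fiF dirF) FT.
have NP : N `<=` P.
  move=> x Nx; apply: FP; exists (submodule_add E0 N); first by exists E0.
  by apply: submodule_add_subr => //; apply: fi_submodule; exact: fiE.
have [E EEE EP] := avoid P maxP NP; apply: EP => x Ex.
apply: FP; exists (submodule_add E N); first by exists E.
exact: submodule_add_subl.
Qed.

End Maximal.

(** * Normality and the frame of pure submodules *)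

Section Regularity.
Variables (R : pzRingType) (M : lmodType R).
Hypothesis projM : projective_in_sigma M.
Hypothesis genM : forall K : set M, is_submodule K -> generated_by K.
Hypothesis harmM : strongly_harmonic M.
Hypothesis compactM : compact_fully_invariant M.
Implicit Types A B C D E K L N P : set M.

(** The submodules [D], [E] separate [A] from [N] like the disjoint open sets of
    a normal space. As for compact Hausdorff spaces, sums of the [E] separating a
    single [P] from the various [Q] above [N], with the intersection of the
    matching [D], separate [P] from [N]; then sums of these [D] over the [P] above
    [A], with the intersection of the matching [E], separate [A] from [N]. *)
Lemma fi_normal A N : fully_invariant A -> fully_invariant N ->
  submodule_add A N = setT ->
  exists D E, [/\ fully_invariant D, fully_invariant E, D `<=` Ann E,
    submodule_add D A = setT & submodule_add E N = setT].
Proof.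
move=> fA fN AN.
have sub0_Ann E : [set 0] `<=` Ann E.
  by move=> _ ->; apply/AnnP => f _; rewrite linear0.
have Ann0 : Ann [set (0 : M)] = setT.
  by apply/seteqP; split=> // x _; apply/AnnP => f f0; exact: f0.
have fi0 := fully_invariant0 M; have fiT := fully_invariantT M.
(* A maximal [P] above [A] is fixed and separated from all of [N] at once. *)
have step P : max_fully_invariant P -> A `<=` P -> exists D E,
    [/\ fully_invariant D, fully_invariant E, D `<=` Ann E, ~ (D `<=` P)
      & submodule_add E N = setT].
  move=> maxP AP; have [fP PT _] := maxP.
  pose EE := [set E | fully_invariant E /\
    exists D, [/\ fully_invariant D, ~ (D `<=` P) & D `<=` Ann E]].
  have [||||E [fE [D [fD DP DE]]] EN] :=
    comaximal_of_avoiding compactM (EE := EE) fN.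
  - exists [set 0]; split=> //; exists setT; split=> //; last by rewrite Ann0.
    by move=> TP; apply: PT; apply/seteqP; split.
  - by move=> E [].
  - move=> E E' [fE [D [fD DP DE]]] [fE' [D' [fD' DP' DE']]].
    split; first exact: fully_invariant_add.
    (* [P] is prime enough: [D] and [D'] are comaximal with [P], hence so is
       their intersection. *)
    exists (D `&` D'); split; first exact: fully_invariantI.
      move=> DDP; apply: PT; apply/seteqP; split=> //.
      have <- : submodule_add (D `&` D') P = setT.
        by apply: comaximalI; rewrite ?max_comaximal //; exact: fi_submodule.
      by apply: submodule_add_sub => //; exact: fi_submodule.
    apply: sub_Ann_add => //; try exact: fi_submodule.
      by move=> x [/DE].
    by move=> x [_ /DE'].
  - move=> Q maxQ NQ; have QP : Q <> P.
      move=> QP; apply: PT; apply/seteqP; split=> //; rewrite -AN.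
      by apply: submodule_add_sub => //; [exact: fi_submodule|rewrite -QP].
    have [E [D [fE fD DP EQ DE]]] := harmM maxQ maxP QP.
    exists E => //; split=> //; exists D; split=> //.
    by apply/submodule_prod_eq0 => //; exact: fi_submodule.
  by exists D, E.
pose DD := [set D | fully_invariant D /\
  exists E, [/\ fully_invariant E, D `<=` Ann E & submodule_add E N = setT]].
have [||||D [fD [E [fE DE EN]]] DA] :=
  comaximal_of_avoiding compactM (EE := DD) fA.
- exists [set 0]; split=> //; exists setT; split=> //.
  apply/seteqP; split=> // x _.
  by apply: submodule_add_subl => //; exact: fi_submodule.
- by move=> D [].
- move=> D D' [fD [E [fE DE EN]]] [fD' [E' [fE' DE' EN']]].
  split; first exact: fully_invariant_add.
  exists (E `&` E'); split; first exact: fully_invariantI.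
    apply: submodule_add_sub; first exact: fi_submodule (fully_invariant_Ann _).
      by move=> x /DE; apply: Ann_anti => y [].
    by move=> x /DE'; apply: Ann_anti => y [].
  by apply: comaximalI => //; exact: fi_submodule.
- move=> P maxP AP; have [D [E [fD fE DE DP EN]]] := step P maxP AP.
  by exists D => //; split=> //; exists E.
by exists D, E.
Qed.

(** For a commutative ring, the elements whose support, a closed set, is
    disjoint from the closed set defined by [C]. *)
Definition pure_part C : set M :=
  [set x | submodule_add C (Ann (cyclic_submodule x)) = setT].

(** The way to produce elements of [pure_part C]: [R x] lies in [E] for [x] in
    [E], so [Ann (R x)] contains [D]. *)
Lemma sub_pure_part D C E : is_submodule E -> D `<=` Ann E ->
  submodule_add C D = setT -> E `<=` pure_part C.
Proof.
move=> sE DE CD x Ex; apply: comaximal_mono CD => // y /DE.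
by apply: Ann_anti; exact: cyclic_submodule_sub.
Qed.

(** Closure under sums combines [sub_Ann_add] and [comaximalI]. For closure under
    an endomorphism [f], every homomorphism from [M] to [R (f x)] lifts along [f]
    to one into [R x], so [Ann (R x)] is contained in [Ann (R (f x))]. *)
Lemma fully_invariant_pure_part C :
  fully_invariant C -> fully_invariant (pure_part C).
Proof.
move=> fC; have sC := fi_submodule fC; have sc := @cyclic_submoduleP R M.
have sA K : is_submodule (Ann K) := fi_submodule (fully_invariant_Ann K).
have monoC x A : A `<=` Ann (cyclic_submodule x) ->
    submodule_add A C = setT -> pure_part C x.
  by move=> AC; rewrite submodule_addC; apply: comaximal_mono.
have pureZ a x : pure_part C x -> pure_part C (a *: x).
  rewrite {1}/pure_part /= submodule_addC; apply: monoC.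
  apply: Ann_anti; apply: cyclic_submodule_sub => //.
  by apply: submoduleZ => //; exact: mem_cyclic.
have pureD x y : pure_part C x -> pure_part C y -> pure_part C (x + y).
  rewrite {1 2}/pure_part /= ![submodule_add C _]submodule_addC => Cx Cy.
  apply: (monoC _ (Ann (cyclic_submodule x) `&` Ann (cyclic_submodule y)));
    last by apply: comaximalI => //; exact: fully_invariant_Ann.
  apply: subset_trans (Ann_anti _); last first.
    apply: (cyclic_submodule_sub (submodule_add_submodule (sc x) (sc y))).
    by exists x; [exact: mem_cyclic|exists y => //; exact: mem_cyclic].
  by apply: sub_Ann_add => // z [].
apply/fully_invariantP; split.
  apply/is_submoduleP; split; last by move=> a x y /(pureZ a) ax; exact: pureD.
  apply: (monoC _ setT).
    by move=> x _; apply/AnnP => f f0; have [r _ <-] := f0 x; exact: scaler0.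
  by apply/seteqP; split=> // x _; apply: submodule_add_subl.
move=> f x; rewrite {1}/pure_part /= submodule_addC; apply: monoC.
move=> y /AnnP xy; apply/AnnP => h hfx.
have [|g [gx fg]] := hom_lift_image projM (f := f) (h := h) (sc x).
  move=> m; have [r _ <-] := hfx m.
  by exists (r *: x); [exists r|exact: linearZ].
by rewrite -fg xy // linear0.
Qed.

(** If [x] is in [pure_part C], normality gives [D] and [E] of vanishing product
    with [D + C = M] and [E + Ann (R x) = M]; then [E] lies in [pure_part C]. *)
Lemma pure_part_Psi C : fully_invariant C -> Psi (pure_part C).
Proof.
move=> fC; split=> [|x Cx]; first exact: fully_invariant_pure_part.
have [D [E [fD fE DE DC EA]]] := fi_normal fC (fully_invariant_Ann _) Cx.
apply: comaximal_mono EA => //; apply: (sub_pure_part (D := D)) => //.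
  exact: fi_submodule.
by rewrite submodule_addC.
Qed.

(** Every [f] from [M] to [K] kills [Ann K], so [f @` M = f @` C] lies in [C];
    such images generate [K]. *)
Lemma sub_of_comaximal_Ann C K : fully_invariant C -> is_submodule K ->
  submodule_add C (Ann K) = setT -> K `<=` C.
Proof.
move=> fC sK CK; apply: generated_sub (genM sK) (fi_submodule fC) _ => f fK m.
have [c Cc [a /AnnP Ka <-]] : submodule_add C (Ann K) m by rewrite CK.
by rewrite linearD (Ka f fK) addr0; exact: fi_hom.
Qed.

Lemma pure_part_sub C : fully_invariant C -> pure_part C `<=` C.
Proof.
move=> fC x Cx; apply: (sub_of_comaximal_Ann fC (cyclic_submoduleP x) Cx).
exact: mem_cyclic.
Qed.

(** The separating pair [D], [E] provides both the witness [pure_part E] and a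
    lower bound [pure_part D] of its pseudocomplement. *)
Lemma Psi_well_inside N n : Psi N -> N n -> exists K,
  [/\ Psi K, K `<=` N, submodule_add N (Psi_compl K) = setT & K n].
Proof.
move=> [fN pureN] Nn.
have [D [E [fD fE DE DN EA]]] :=
  fi_normal fN (fully_invariant_Ann _) (pureN n Nn).
have [sD sE] := (fi_submodule fD, fi_submodule fE).
have EN : E `<=` N.
  apply: sub_of_comaximal_Ann => //; rewrite submodule_addC.
  exact: comaximal_mono DN.
exists (pure_part E); split.
- exact: pure_part_Psi.
- exact: subset_trans (pure_part_sub fE) EN.
- have [D' [E' [fD' fE' DE' DD EN']]] := fi_normal fD fN DN.
  rewrite submodule_addC; apply: comaximal_mono EN' => //.
  (* A second separation, of [D] from [N], shrinks [D] to its pure part without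
     losing comaximality with [N]. *)
  have E'D : E' `<=` pure_part D.
    by apply: (sub_pure_part (fi_submodule fE') DE'); rewrite submodule_addC.
  apply: subset_trans E'D _; apply: (@sub_submodule_sum _ _ _ _ id).
  split; first exact: pure_part_Psi.
  apply/submodule_prod_eq0.
    by apply: fi_submodule; exact: fully_invariant_pure_part.
  apply: subset_trans (pure_part_sub fD) (subset_trans DE _).
  exact: Ann_anti (pure_part_sub fE).
- exact: EA.
Qed.

End Regularity.

Theorem theorem4p25 (R : pzRingType) (M : lmodType R) :
  self_progenerator M -> strongly_harmonic M -> compact_fully_invariant M ->
  Psi_regular M.
Proof.
move=> [projM genM] harmM compactM N PN; apply/seteqP; split.
  move=> n Nn; have [K [PK KN NK Kn]] :=
    Psi_well_inside projM genM harmM compactM PN Nn.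
  exact: (@sub_submodule_sum _ _ _ _ id K).
by apply: submodule_sum_sub => [|K []//]; case: PN => /fi_submodule.
Qed.
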